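(* Let $N\ge 1$. The direct spectral transform $$(\mathbb{R}^+)^{2N-1}\to\Lambda,\qquad (a_1,\ldots,a_N,b_1,\ldots,b_{N-1})\mapsto(\lambda_1,\ldots,\lambda_N,w_1,\ldots,w_N)$$ is a bijection from $(\mathbb{R}^+)^{2N-1}$ onto $$\Lambda=\Bigl\{(\lambda_1,\ldots,\lambda_N,w_1,\ldots,w_N)\ :\ 0<\lambda_1<\cdots<\lambda_N<\infty,\ w_j>0 \text{ for all } j,\ \sum_{j=1}^N w_j=1\Bigr\}.$$
   Context: $\mathbb{R}^+=(0,\infty)$. Given $a_1,\ldots,a_N>0$ and $b_1,\ldots,b_{N-1}>0$, let $L$ be the $N\times N$ upper bidiagonal matrix with diagonal entries $L_{n,n}=a_n$, superdiagonal entries $L_{n,n+1}=1$, and all other entries $0$; let $M$ be the $N\times N$ lower bidiagonal matrix with $M_{n,n}=1$, $M_{n+1,n}=-b_n$, and all other entries $0$. The generalized eigenvalue problem $L\vec x=\lambda M\vec x$ has $N$ distinct positive eigenvalues (the zeros of $\det(zM-L)$), denoted $0<\lambda_1<\cdots<\lambda_N$. For each $j$ let $\vec v_j$ and $\vec u_j$ be the right and left eigenvectors, $L\vec v_j=\lambda_j M\vec v_j$ and $\vec u_j^{\,T}L=\lambda_j\vec u_j^{\,T}M$, both normalized to have first component equal to $1$ (always possible). Then $\vec u_j^{\,T}M\vec v_j\ne 0$ and one defines $w_j=(\vec u_j^{\,T}M\vec v_j)^{-1}$. The direct spectral transform sends $(a_1,\ldots,a_N,b_1,\ldots,b_{N-1})$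 to $(\lambda_1,\ldots,\lambda_N,w_1,\ldots,w_N)$. *)

(* Defs.v *)
From mathcomp Require Import all_boot all_order all_algebra.
From mathcomp Require Import classical_sets functions reals.

Set Implicit Arguments.
Unset Strict Implicit.
Unset Printing Implicit Defensive.

Import Order.TTheory GRing.Theory Num.Theory.
Local Open Scope classical_set_scope.
Local Open Scope ring_scope.

(* Throughout N = n.+1, so that N >= 1; indices start at 0, hence the vectors
   a, lambda, w have entries 0, ..., n and b has entries 0, ..., n - 1. *)

(* k and k + 1 as indices of a vector of length n.+1. *)
Definition ord_cur n (k : 'I_n) : 'I_n.+1 := widen_ord (leqnSn n) k.
Definition ord_next n (k : 'I_n) : 'I_n.+1 := lift ord0 k.

Section Pencil.
Variables (R : realType) (n : nat).
Implicit Types (a : 'rV[R]_n.+1) (b : 'rV[R]_n) (L M : 'M[R]_n.+1).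

Definition Lmx a : 'M[R]_n.+1 :=
  diag_mx a + \sum_(k < n) delta_mx (ord_cur k) (ord_next k).

Definition Mmx b : 'M[R]_n.+1 :=
  1%:M - \sum_(k < n) b 0 k *: delta_mx (ord_next k) (ord_cur k).

Definition gen_eigenvalue L M (z : R) : Prop :=
  exists2 x : 'cV[R]_n.+1, x != 0 & L *m x = z *: (M *m x).

Definition increasing (l : 'rV[R]_n.+1) : Prop :=
  forall i j : 'I_n.+1, (i < j)%N -> l 0 i < l 0 j.

(* The three definitions below pick "the" object with a given property; the
   value is 0 if there is none. Such a default never yields a point of Lambda:
   a null vector of eigenvalues is not positive, and a null eigenvector gives
   the weight 0^-1 = 0. *)

Definition eigenvalues L M : 'rV[R]_n.+1 :=
  xget 0 [set l : 'rV[R]_n.+1 | increasing l /\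
    forall z, gen_eigenvalue L M z <-> exists j, z = l 0 j].

Definition right_eigenvector L M (z : R) : 'cV[R]_n.+1 :=
  xget 0 [set v : 'cV[R]_n.+1 | L *m v = z *: (M *m v) /\ v ord0 0 = 1].

Definition left_eigenvector L M (z : R) : 'cV[R]_n.+1 :=
  xget 0 [set u : 'cV[R]_n.+1 | u^T *m L = z *: (u^T *m M) /\ u ord0 0 = 1].

Definition weight L M (z : R) : R :=
  (((left_eigenvector L M z)^T *m M *m right_eigenvector L M z) 0 0)^-1.

Definition spectral_transform (ab : 'rV[R]_n.+1 * 'rV[R]_n) :
    'rV[R]_n.+1 * 'rV[R]_n.+1 :=
  let L := Lmx ab.1 in
  let M := Mmx ab.2 in
  let l := eigenvalues L M in
  (l, \row_j weight L M (l 0 j)).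

Definition pos_params : set ('rV[R]_n.+1 * 'rV[R]_n) :=
  [set ab : 'rV[R]_n.+1 * 'rV[R]_n |
    (forall i, 0 < ab.1 0 i) /\ (forall k, 0 < ab.2 0 k)].

Definition Lambda : set ('rV[R]_n.+1 * 'rV[R]_n.+1) :=
  [set lw : 'rV[R]_n.+1 * 'rV[R]_n.+1 |
    [/\ forall j, 0 < lw.1 0 j, increasing lw.1,
        forall j, 0 < lw.2 0 j & \sum_j lw.2 0 j = 1]].

End Pencil.

Arguments spectral_transform {R n} ab.
Arguments pos_params R n : clear implicits.
Arguments Lambda R n : clear implicits.

(* Main.v *)
Require Import Defs.
From mathcomp Require Import all_boot all_order all_algebra.
From mathcomp Require Import classical_sets functions reals.
From mathcomp Require Import polyorder polyrcf zify ring lra.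

(* Let P and Q be the determinants of z M - L and of its trailing block obtained
   by deleting the first row and column. Eigenvectors can be written with the
   trailing determinants, which gives w_j = Q(lambda_j) / P'(lambda_j): the
   spectral data are the poles and residues of Q / P. Expanding along the first
   row, P = (z - a_1) Q - b_1 z S, where S is the next trailing determinant.
   Evaluation at 0 and leading coefficients recover a_1, b_1 and S from (P, Q),
   and positivity of the residues of Q / P (i.e. interlacing of the roots) passes
   from (Q, S) to (P, Q) and back, so the bijection follows by induction on N. *)

Set Implicit Arguments.
Unset Strict Implicit.
Unset Printing Implicit Defensive.

Import Order.TTheory GRing.Theory Num.Theory.
Local Open Scope ring_scope.

(** * Interlacing real-rooted polynomials *)

Section RootPoly.
Variable R : realType.

(** Recurrences run over [nat], so vectors become sequences. The default [x0] carries the boundary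
    condition: [0] for missing matrix entries, a right endpoint in [roots_outside]. *)
Definition extend (x0 : R) n (v : 'rV[R]_n) (k : nat) : R :=
  oapp (v 0) x0 (insub k).

Lemma extend_ord x0 n (v : 'rV[R]_n) (i : 'I_n) : extend x0 v i = v 0 i.
Proof. by rewrite /extend valK. Qed.

Lemma extend_ge x0 n (v : 'rV[R]_n) k : (n <= k)%N -> extend x0 v k = x0.
Proof. by move=> nk; rewrite /extend insubN // -leqNgt. Qed.

Definition root_poly n (l : 'rV[R]_n) : {poly R} :=
  \prod_j ('X - (l 0 j)%:P).

Lemma root_poly_monic n (l : 'rV[R]_n) : root_poly l \is monic.
Proof. exact: monic_prod_XsubC. Qed.

Lemma size_root_poly n (l : 'rV[R]_n) : size (root_poly l) = n.+1.
Proof. by rewrite size_prod_XsubC /index_enum -enumT size_enum_ord. Qed.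

Lemma horner_root_poly n (l : 'rV[R]_n) x :
  (root_poly l).[x] = \prod_j (x - l 0 j).
Proof. by rewrite horner_prod; apply: eq_bigr => j _; rewrite !hornerE. Qed.

Lemma root_root_poly n (l : 'rV[R]_n) z :
  (root_poly l).[z] = 0 <-> exists j, z = l 0 j.
Proof.
rewrite horner_root_poly; split => [/eqP/prodf_eq0[j _]|[j ->]].
  by rewrite subr_eq0 => /eqP ->; exists j.
by rewrite (bigD1 j) //= subrr mul0r.
Qed.

Lemma root_polyD1 n (l : 'rV[R]_n.+1) j :
  root_poly l = ('X - (l 0 j)%:P) * root_poly (col' j l).
Proof.
rewrite /root_poly (bigD1_ord j) //=; congr (_ * _).
by apply: eq_bigr => k _; rewrite mxE.
Qed.

Lemma deriv_root_poly n (l : 'rV[R]_n.+1) j :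
  (root_poly l)^`().[l 0 j] = \prod_k (l 0 j - l 0 (lift j k)).
Proof.
rewrite (root_polyD1 l j) derivM !derivE !hornerE subrr mul0r addr0.
by rewrite horner_root_poly; apply: eq_bigr => k _; rewrite mxE.
Qed.

Lemma deriv_root_polyD1 n (l : 'rV[R]_n.+1) j :
  (root_poly l)^`().[l 0 j] = \prod_(k | k != j) (l 0 j - l 0 k).
Proof.
rewrite /root_poly (bigD1 j) //= derivM !derivE !hornerE subrr mul0r addr0.
by rewrite horner_prod; apply: eq_bigr => k _; rewrite !hornerE.
Qed.

Lemma increasing_inj n (l : 'rV[R]_n.+1) : increasing l -> injective (l 0).
Proof.
move=> linc i j lij; apply/val_inj; case: (ltngtP i j) => // /linc;
by rewrite lij ltxx.
Qed.

Lemma increasing_le n (l : 'rV[R]_n.+1) (i j : 'I_n.+1) :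
  increasing l -> (i <= j)%N -> l 0 i <= l 0 j.
Proof.
move=> linc; rewrite leq_eqVlt => /orP[/eqP/val_inj -> //|/linc /ltW //].
Qed.

Lemma deriv_root_poly_neq0 n (l : 'rV[R]_n.+1) j :
  increasing l -> (root_poly l)^`().[l 0 j] != 0.
Proof.
move=> linc; rewrite deriv_root_poly; apply/prodf_neq0 => k _.
by rewrite subr_eq0 (inj_eq (increasing_inj linc)) neq_lift.
Qed.

(** * Polynomials determined by their values at increasing nodes *)

Lemma poly_eq0_at_nodes n (l : 'rV[R]_n.+1) (p : {poly R}) :
  increasing l -> (size p <= n.+1)%N -> (forall j, p.[l 0 j] = 0) -> p = 0.
Proof.
move=> linc sp p0; apply: (@roots_geq_poly_eq0 _ p (codom (l 0))).
- by apply/allP => _ /codomP[j ->]; apply/rootP.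
- by apply/injectiveP/increasing_inj.
- by rewrite size_codom card_ord.
Qed.

Lemma size_monicB n (p q : {poly R}) : p \is monic -> q \is monic ->
  size p = n.+1 -> size q = n.+1 -> (size (p - q)%R <= n)%N.
Proof.
move=> /monicP pm /monicP qm sp sq; apply/leq_sizeP => k.
rewrite leq_eqVlt => /orP[/eqP <-|nk].
  by move: pm qm; rewrite /lead_coef sp sq /= coefB => -> ->; rewrite subrr.
by rewrite coefB !nth_default ?subr0 // ?sp ?sq.
Qed.

Lemma root_polyP n (l : 'rV[R]_n.+1) (p : {poly R}) :
  increasing l -> p \is monic -> size p = n.+2 -> (forall j, p.[l 0 j] = 0) ->
  p = root_poly l.
Proof.
move=> linc pm sp p0; apply/eqP; rewrite -subr_eq0; apply/eqP.
apply: (poly_eq0_at_nodes linc) => [|j]; last first.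
  by rewrite !hornerE p0 (root_root_poly _ _).2 ?subr0 //; exists j.
by apply: size_monicB => //; rewrite ?root_poly_monic ?size_root_poly.
Qed.

(** Numerator of the rational function with simple poles [l] and residues [c]: divided by
    [root_poly l] it is the sum of c_j / (X - l_j). *)
Definition interpolant n (l c : 'rV[R]_n.+1) : {poly R} :=
  \sum_j c 0 j *: root_poly (col' j l).

Lemma size_interpolant n (l c : 'rV[R]_n.+1) : (size (interpolant l c) <= n.+1)%N.
Proof.
rewrite (leq_trans (size_sum _ _ _)) //; apply/bigmax_leqP => j _.
by rewrite (leq_trans (size_scale_leq _ _)) // size_root_poly.
Qed.

Lemma coef_interpolant n (l c : 'rV[R]_n.+1) : (interpolant l c)`_n = \sum_j c 0 j.
Proof.
rewrite coef_sum; apply: eq_bigr => j _; rewrite coefZ.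
have /monicP := root_poly_monic (col' j l).
by rewrite /lead_coef size_root_poly /= => ->; rewrite mulr1.
Qed.

Lemma horner_interpolant n (l c : 'rV[R]_n.+1) j :
  (interpolant l c).[l 0 j] = c 0 j * (root_poly l)^`().[l 0 j].
Proof.
rewrite horner_sum (bigD1 j) //= big1 ?addr0 => [|k kj].
  rewrite hornerZ horner_root_poly deriv_root_poly; congr (_ * _).
  by apply: eq_bigr => k _; rewrite mxE.
rewrite hornerZ (root_root_poly _ _).2 ?mulr0 //.
have [m ->|jk] := unliftP k j; last by rewrite jk eqxx in kj.
by exists m; rewrite mxE.
Qed.

Lemma poly_eq_at_nodes n (l : 'rV[R]_n.+1) (p q : {poly R}) :
  increasing l -> (size p <= n.+1)%N -> (size q <= n.+1)%N ->
  (forall j, p.[l 0 j] = q.[l 0 j]) -> p = q.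
Proof.
move=> linc sp sq pq; apply/eqP; rewrite -subr_eq0; apply/eqP.
apply: (poly_eq0_at_nodes linc) => [|j]; last by rewrite !hornerE pq subrr.
by rewrite (leq_trans (size_polyD _ _)) // geq_max sp size_polyN.
Qed.

(** The summands are the residues of [p / root_poly l], read off the Lagrange form of [p]. This
    yields both the total mass of the weights and the sign of [c] in [tail_poly_surj]. *)
Lemma lead_coef_at_nodes n (l : 'rV[R]_n.+1) (p : {poly R}) :
  increasing l -> (size p <= n.+1)%N ->
  p`_n = \sum_j p.[l 0 j] / (root_poly l)^`().[l 0 j].
Proof.
move=> linc sp.
pose c : 'rV_n.+1 := \row_j (p.[l 0 j] / (root_poly l)^`().[l 0 j]).
have -> : p = interpolant l c.
  apply: (poly_eq_at_nodes linc sp (size_interpolant _ _)) => j.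
  by rewrite horner_interpolant mxE divfK // deriv_root_poly_neq0.
rewrite coef_interpolant; apply: eq_bigr => j _.
by rewrite horner_interpolant mulfK // deriv_root_poly_neq0.
Qed.

Lemma increasing_sorted n (l : 'rV[R]_n.+1) : increasing l ->
  sorted <%O [seq l 0 j | j <- enum 'I_n.+1].
Proof.
move=> linc; rewrite sorted_map; apply: (@sub_sorted _ (relpre val ltn)).
  exact: linc.
by rewrite -sorted_map val_enum_ord iota_ltn_sorted.
Qed.

Lemma increasing_eq n (l m : 'rV[R]_n.+1) : increasing l -> increasing m ->
  (forall z, (exists j, z = l 0 j) <-> (exists j, z = m 0 j)) -> l = m.
Proof.
move=> linc minc lm.
have /eq_in_map h : [seq l 0 j | j <- enum 'I_n.+1] = [seq m 0 j | j <- enum 'I_n.+1].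
  apply: lt_sorted_eq; rewrite ?increasing_sorted // => z.
  apply/mapP/mapP => -[j _ zj].
    have /lm[k zk] : exists j, z = l 0 j by exists j.
    by exists k; rewrite // mem_enum.
  have /lm[k zk] : exists j, z = m 0 j by exists j.
  by exists k; rewrite // mem_enum.
by apply/rowP => j; apply: h; rewrite mem_enum.
Qed.

(** * Interlacing and sign patterns *)

Definition interlacing n (l : 'rV[R]_n.+1) (m : 'rV[R]_n) : Prop :=
  forall k, l 0 (ord_cur k) < m 0 k < l 0 (ord_next k).

Lemma interlacing_increasing n (l : 'rV[R]_n.+2) (m : 'rV[R]_n.+1) :
  increasing l -> interlacing l m -> increasing m.
Proof.
move=> linc lm i j ij; have /andP[_ h1] := lm i; have /andP[h2 _] := lm j.
apply: lt_le_trans h1 (le_trans _ (ltW h2)).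
by apply: increasing_le => //=; rewrite lift0.
Qed.

Lemma interlacing_increasing_outer n (l : 'rV[R]_n.+2) (m : 'rV[R]_n.+1) :
  increasing m -> interlacing l m -> increasing l.
Proof.
move=> minc lm i j ij.
have [/= i0 Ei|Ei] := unliftP ord_max i; last first.
  by have := leq_ord j; rewrite leqNgt (leq_trans _ ij) // Ei.
have [/= j0 Ej|Ej] := unliftP ord0 j; last by rewrite Ej ltn0 in ij.
have -> : i = ord_cur i0 by apply/val_inj; rewrite /= Ei lift_max.
have -> : j = ord_next j0 by [].
have /andP[h1 _] := lm i0; have /andP[_ h2] := lm j0.
apply: lt_le_trans h1 (le_trans _ (ltW h2)).
by apply: increasing_le => //; move: ij; rewrite Ei Ej /= /bump; have := ltn_ord i0; lia.
Qed.

Lemma interlacing_pos n (l : 'rV[R]_n.+2) (m : 'rV[R]_n.+1) :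
  (forall j, 0 < l 0 j) -> interlacing l m -> forall j, 0 < m 0 j.
Proof. by move=> l0 lm j; have /andP[] := lm j => h _; apply: lt_trans h. Qed.

(** Multiply the two products index by index: any other node lies on the same side of both chosen
    nodes, so only the factor comparing these two with each other is negative. *)
Lemma deriv_root_poly_alternate n (l : 'rV[R]_n.+1) (k : 'I_n) :
  increasing l ->
  (root_poly l)^`().[l 0 (ord_cur k)] * (root_poly l)^`().[l 0 (ord_next k)] < 0.
Proof.
move=> linc; rewrite !deriv_root_poly -big_split (bigD1 k) //=.
rewrite nmulr_rlt0; last first.
  have -> : lift (ord_cur k) k = ord_next k.
    by apply/val_inj; rewrite /= /bump leqnn.
  have -> : lift (ord_next k) k = ord_cur k.
    by apply/val_inj; rewrite /= /bump add1n ltnn.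
  have: l 0 (ord_cur k) < l 0 (ord_next k) by apply: linc; rewrite lift0 /=.
  by move=> ?; nra.
apply: prodr_gt0 => i; rewrite neq_ltn /= => /orP[ik|ki].
  by apply: mulr_gt0; rewrite subr_gt0; apply: linc; rewrite /= /bump; lia.
by rewrite -mulrNN; apply: mulr_gt0; rewrite oppr_gt0 subr_lt0; apply: linc;
  rewrite /= /bump; lia.
Qed.

(** Factor by factor, [m 0 k] and [l 0 (lift j k)] lie on the same side of [l 0 j]. *)
Lemma interlacing_outer_sign n (l : 'rV[R]_n.+1) (m : 'rV[R]_n) j :
  increasing l -> interlacing l m ->
  0 < (root_poly m).[l 0 j] * (root_poly l)^`().[l 0 j].
Proof.
move=> linc lm; rewrite horner_root_poly deriv_root_poly -big_split /=.
apply: prodr_gt0 => k _; have /andP[h1 h2] := lm k.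
have [kj|jk] := ltnP k j.
  have h3 : l 0 (ord_next k) <= l 0 j.
    by apply: increasing_le => //; rewrite lift0.
  have h4 : l 0 (lift j k) < l 0 j by apply: linc; rewrite /= /bump; lia.
  by apply: mulr_gt0; lra.
have h3 : l 0 j <= l 0 (ord_cur k) by apply: increasing_le.
have h4 : l 0 j < l 0 (lift j k) by apply: linc; rewrite /= /bump; lia.
by rewrite -mulrNN; apply: mulr_gt0; lra.
Qed.

(** The two neighbours of [m 0 j] in [l] give factors of opposite signs; each remaining entry of [l]
    is paired with an entry of [m] on the same side of [m 0 j]. *)
Lemma interlacing_inner_sign n (l : 'rV[R]_n.+2) (m : 'rV[R]_n.+1) j :
  increasing l -> interlacing l m ->
  (root_poly l).[m 0 j] * (root_poly m)^`().[m 0 j] < 0.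
Proof.
move=> linc lm; have minc := interlacing_increasing linc lm.
rewrite horner_root_poly deriv_root_polyD1 (bigD1_ord (ord_cur j)) //=.
rewrite (bigD1 j) //=.
have -> : lift (ord_cur j) j = ord_next j.
  by apply/val_inj; rewrite /= /bump leqnn.
have /andP[h1 h2] := lm j.
rewrite mulrA -[X in X < 0]mulrA -big_split /= nmulr_rlt0; last by nra.
apply: prodr_gt0 => i ij; have /andP[h3 h4] := lm i.
move: ij; rewrite neq_ltn /= => /orP[ij|ji].
  have h5 := minc _ _ ij.
  have h6 : l 0 (lift (ord_cur j) i) <= l 0 (ord_cur i).
    by apply: increasing_le => //=; rewrite /bump; lia.
  by apply: mulr_gt0; lra.
have h5 := minc _ _ ji.
have h6 : l 0 (ord_next i) <= l 0 (lift (ord_cur j) i).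
  by apply: increasing_le => //=; rewrite /bump; lia.
by rewrite -mulrNN; apply: mulr_gt0; lra.
Qed.

(** The intermediate value theorem gives one root in each of the n gaps, and [p] has degree n. *)
Lemma roots_between n (e : 'rV[R]_n.+1) (p : {poly R}) :
  increasing e -> p \is monic -> size p = n.+1 ->
  (forall k, p.[e 0 (ord_cur k)] * p.[e 0 (ord_next k)] < 0) ->
  exists2 m, interlacing e m & p = root_poly m.
Proof.
move=> einc pm sp sgn.
have h k : exists x, (e 0 (ord_cur k) < x < e 0 (ord_next k)) && (p.[x] == 0).
  have le : e 0 (ord_cur k) <= e 0 (ord_next k).
    by apply/ltW/einc; rewrite lift0 /=.
  have [x xin /eqP px] := poly_ivtoo le (sgn k); exists x.
  by rewrite px eqxx andbT; rewrite in_itv in xin.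
pose m := \row_k xchoose (h k).
have lm : interlacing e m.
  by move=> k; rewrite mxE; have /andP[] := xchooseP (h k).
(* [root_polyP] needs at least one node; when there is no gap, the monic constant [p] is 1. *)
exists m => //; case: n => [|n] in e p einc pm sp sgn h m lm *.
  rewrite /root_poly big_ord0; apply/eqP; rewrite -subr_eq0.
  have /size_poly1P[c c0 pE] : size p == 1%N by rewrite sp.
  by move: pm; rewrite pE monicE lead_coefC => /eqP ->; rewrite subrr.
apply: root_polyP => // [|j]; first exact: interlacing_increasing lm.
by rewrite mxE; have /andP[_ /eqP] := xchooseP (h j).
Qed.

Lemma interlacing_horner0_sign n (l : 'rV[R]_n.+2) (m : 'rV[R]_n.+1) :
  (forall j, 0 < l 0 j) -> (forall j, 0 < m 0 j) ->
  (root_poly l).[0] * (root_poly m).[0] < 0.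
Proof.
move=> l0 m0; rewrite !horner_root_poly big_ord_recl -mulrA -big_split /=.
rewrite nmulr_rlt0 ?sub0r ?oppr_lt0 //; apply: prodr_gt0 => i _.
by rewrite !sub0r mulrNN mulr_gt0.
Qed.

(** Carries a sign change between reference values [u] and [v] over to [x] and [y]; the references
    are, up to sign, values of a [root_poly] or of its derivative. *)
Lemma signs_transfer (x y u v : R) :
  x * u < 0 -> y * v < 0 -> u * v < 0 -> x * y < 0.
Proof.
by move=> xu yv uv; rewrite -(nmulr_lgt0 _ uv) mulrACA -mulrNN;
  apply: mulr_gt0; rewrite oppr_gt0.
Qed.

Lemma root_poly0_sign n (m : 'rV[R]_n.+1) :
  increasing m -> (forall j, 0 < m 0 j) ->
  (root_poly m).[0] * (root_poly m)^`().[m 0 ord0] < 0.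
Proof.
move=> minc m0; rewrite horner_root_poly deriv_root_poly big_ord_recl.
rewrite -mulrA -big_split /= nmulr_rlt0; last by rewrite sub0r oppr_lt0.
apply: prodr_gt0 => i _; rewrite -mulrNN; apply: mulr_gt0.
  by rewrite oppr_gt0 sub0r oppr_lt0.
by rewrite oppr_gt0 subr_lt0; apply: minc; rewrite /= /bump; lia.
Qed.

Lemma deriv_root_poly_max_gt0 n (m : 'rV[R]_n.+1) :
  increasing m -> 0 < (root_poly m)^`().[m 0 ord_max].
Proof.
move=> minc; rewrite deriv_root_poly; apply: prodr_gt0 => i _.
by rewrite subr_gt0; apply: minc; rewrite lift_max /=.
Qed.

Lemma monic_gt0_right (p : {poly R}) x :
  p \is monic -> exists2 B, x < B & 0 < p.[B].
Proof.
move=> /monicP pm; have p1 : 0 < lead_coef p by rewrite pm.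
have [N hN] := poly_pinfty_gt_lc p1; exists (Num.max N (x + 1)).
  by rewrite lt_max ltrDl ltr01 orbT.
by apply: lt_le_trans p1 (hN _ _); rewrite le_max lexx.
Qed.

(** The polynomial [p] changes sign on each gap of the list 0, m_0, ..., m_n, B for a large B, so
    [roots_between] finds all its roots; the left endpoint 0 makes them positive. *)
Lemma roots_outside n (m : 'rV[R]_n.+1) (p : {poly R}) :
  increasing m -> (forall j, 0 < m 0 j) -> p \is monic -> size p = n.+3 ->
  (forall j, p.[m 0 j] * (root_poly m)^`().[m 0 j] < 0) ->
  p.[0] * (root_poly m).[0] < 0 ->
  exists l, [/\ increasing l, forall j, 0 < l 0 j, interlacing l m &
    p = root_poly l].
Proof.
move=> minc m0 pm sp psgn p0.
have [B mB pB] := monic_gt0_right (m 0 ord_max) pm.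
pose f k := if k is k'.+1 then extend B m k' else 0.
pose e : 'rV[R]_n.+3 := \row_i f i.
have f0 : f 0%N = 0 by [].
have fS (i : 'I_n.+1) : f i.+1 = m 0 i by rewrite /f extend_ord.
have fB : f n.+2 = B by rewrite /f extend_ge.
(* There are three kinds of gap: from 0 to the first entry of [m], between consecutive entries, and
   from the last entry, where [p] is negative, to [B]. *)
have step k : (k < n.+2)%N -> f k < f k.+1 /\ p.[f k] * p.[f k.+1] < 0.
  case: k => [|k] kn.
    rewrite f0 (fS ord0) m0; split=> //.
    exact: signs_transfer p0 (psgn ord0) (root_poly0_sign minc m0).
  move: (kn : (k < n.+1)%N) => {}kn.
  rewrite (fS (Ordinal kn)); case: (ltngtP k n) => [kn'||kn'].
  - rewrite (fS (Ordinal (kn' : k.+1 < n.+1)%N)).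
    split; first exact: minc.
    apply: signs_transfer (psgn _) (psgn _) _.
    have := deriv_root_poly_alternate (Ordinal kn') minc.
    by congr (_.[m 0 _] * _.[m 0 _] < 0); apply/val_inj.
  - by move=> ?; lia.
  - rewrite (_ : Ordinal kn = ord_max); last exact/val_inj.
    rewrite kn' fB; split=> //.
    by rewrite nmulr_rlt0 // -(pmulr_llt0 _ (deriv_root_poly_max_gt0 minc)).
have flt i j : (i < j)%N -> (j < n.+3)%N -> f i < f j.
  elim: j => // j IH; rewrite ltnS leq_eqVlt => /orP[/eqP ->|ij] jn.
    by have [] := step j jn.
  by apply: lt_trans (IH ij (ltnW jn)) _; have [] := step j jn.
have einc : increasing e by move=> i j ij; rewrite !mxE; apply: flt.
have [|l el pl] := roots_between einc pm sp.
  by move=> k; rewrite !mxE lift0; have [] := step k (ltn_ord k).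
(* Entry k of [m] is entry k + 1 of [e], the common endpoint of the gaps containing l_k and
   l_{k+1}. *)
have lm : interlacing l m.
  move=> k; have /andP[_] := el (ord_cur k); have /andP[+ _] := el (ord_next k).
  by rewrite !mxE /= add0n extend_ord => -> ->.
exists l; split=> //; first exact: interlacing_increasing_outer lm.
move=> j; have /andP[+ _] := el j; apply: le_lt_trans; rewrite mxE.
case: j => [[|k] kn]; first exact: lexx.
by rewrite [f _](fS (Ordinal (kn : (k < n.+1)%N))) ltW.
Qed.

End RootPoly.


(** * Trailing determinants and their inverse problem *)

Section TailPoly.
Variable R : realType.
Implicit Types (al be : nat -> R) (P Q : {poly R}).

(** Determinant recurrence of a tridiagonal matrix: the off-diagonal entries -1 and -be X multiply
    to the coefficient of the last term, which is absent for a block of size 1. *)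
Fixpoint tail_poly al be (m : nat) : {poly R} :=
  if m is m1.+1 then
    ('X - (al m1)%:P) * tail_poly al be m1 -
    (if m1 is m2.+1 then (be m2)%:P * 'X * tail_poly al be m2 else 0)
  else 1.

Lemma tail_polySS al be m : tail_poly al be m.+2 =
  ('X - (al m.+1)%:P) * tail_poly al be m.+1
  - (be m)%:P * 'X * tail_poly al be m.
Proof. by []. Qed.

Lemma tail_poly1 al be : tail_poly al be 1 = 'X - (al 0%N)%:P.
Proof. by rewrite /= mulr1 subr0. Qed.

Lemma eq_tail_poly al be al' be' m :
  (forall k, (k < m)%N -> al k = al' k) ->
  (forall k, (k.+1 < m)%N -> be k = be' k) ->
  tail_poly al be m = tail_poly al' be' m.
Proof.
suff: forall k, (k < m)%N ->
    (forall i, (i < k.+1)%N -> al i = al' i) ->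
    (forall i, (i.+1 < k.+1)%N -> be i = be' i) ->
    tail_poly al be k = tail_poly al' be' k /\
    tail_poly al be k.+1 = tail_poly al' be' k.+1.
  by case: m => // m h ha hb; have [] := h m (ltnSn m) ha hb.
elim=> [|k IH] km ha hb; first by split=> //; rewrite !tail_poly1 ha.
have [||h1 h2] := IH (ltnW km).
- by move=> i ik; apply: ha; lia.
- by move=> i ik; apply: hb; lia.
by split=> //; rewrite !tail_polySS h1 h2 ha // hb.
Qed.

Lemma size_tail_poly_monic al be m :
  size (tail_poly al be m) = m.+1 /\ tail_poly al be m \is monic.
Proof.
suff [] : (size (tail_poly al be m) = m.+1 /\ tail_poly al be m \is monic) /\
  (size (tail_poly al be m.+1) = m.+2 /\ tail_poly al be m.+1 \is monic) by [].
elim: m => [|m [[s1 m1] [s2 m2]]].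
  by rewrite tail_poly1 size_XsubC monicXsubC size_poly1 monic1.
split=> //; rewrite tail_polySS.
have sA : size (('X - (al m.+1)%:P) * tail_poly al be m.+1) = m.+3.
  by rewrite size_monicM ?monicXsubC ?monic_neq0 // size_XsubC s2.
have sB : (size (- ((be m)%:P * 'X * tail_poly al be m)) < m.+3)%N.
  rewrite size_polyN -mulrA mul_polyC ltnS (leq_trans (size_scale_leq _ _)) //.
  by rewrite size_monicM ?monicX ?monic_neq0 // size_polyX s1.
by rewrite size_polyDl ?sA // monicE lead_coefDl ?sA // -monicE monicMl ?monicXsubC.
Qed.

Lemma size_tail_poly al be m : size (tail_poly al be m) = m.+1.
Proof. by have [] := size_tail_poly_monic al be m. Qed.

Lemma tail_poly_monic al be m : tail_poly al be m \is monic.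
Proof. by have [] := size_tail_poly_monic al be m. Qed.

(** The [be] term carries a factor X, so evaluation at 0 isolates the newest [al]. *)
Lemma tail_poly_horner0 al be m :
  (tail_poly al be m.+1).[0] = - al m * (tail_poly al be m).[0].
Proof.
case: m => [|m]; first by rewrite tail_poly1 !hornerE.
by rewrite tail_polySS !hornerE; ring.
Qed.

Lemma tail_poly_horner0_neq0 al be m :
  (forall k, (k < m)%N -> 0 < al k) -> (tail_poly al be m).[0] != 0.
Proof.
elim: m => [|m IH] al0; first by rewrite hornerE oner_eq0.
rewrite tail_poly_horner0 mulf_neq0 ?IH // => [|k km].
  by rewrite oppr_eq0 gt_eqF // al0.
by rewrite al0 // ltnW.
Qed.

Lemma tail_poly_inj al be al' be' n :
  (forall k, (k <= n)%N -> 0 < al k) -> (forall k, (k < n)%N -> 0 < be k) ->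
  tail_poly al be n.+1 = tail_poly al' be' n.+1 ->
  tail_poly al be n = tail_poly al' be' n ->
  (forall k, (k <= n)%N -> al k = al' k) /\
  (forall k, (k < n)%N -> be k = be' k).
Proof.
elim: n => [|n IH] al0 be0 e2 e1.
  split=> // k; rewrite leqn0 => /eqP ->.
  move/(congr1 (fun p => p.[0])): e2.
  by rewrite !tail_poly1 !hornerE => /oppr_inj.
have ea : al n.+1 = al' n.+1.
  move/(congr1 (fun p => p.[0])): (e2); rewrite [LHS]tail_poly_horner0 [RHS]tail_poly_horner0 -e1.
  move/mulIf => /(_ (tail_poly_horner0_neq0 _ _)) h.
  by apply: oppr_inj; apply: h => k kn; apply: al0; lia.
(* With equal [al] terms removed, the recurrences leave be X times the older polynomial; X cancels,
   and monicity then identifies [be n]. *)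
have e0 : (be n)%:P * tail_poly al be n = (be' n)%:P * tail_poly al' be' n.
  apply: (mulfI (monic_neq0 (monicX R))); rewrite !mulrA ![_ * _%:P]mulrC.
  by move: e2; rewrite !tail_polySS e1 ea => /addrI /oppr_inj.
have eb : be n = be' n.
  move/(congr1 lead_coef): (e0).
  by rewrite !mul_polyC !lead_coefZ !(monicP (tail_poly_monic _ _ _)) !mulr1.
have e0' : tail_poly al be n = tail_poly al' be' n.
  move: e0; rewrite -eb => /mulfI; apply.
  by rewrite polyC_eq0 gt_eqF // be0.
have [||ha hb] := IH _ _ e1 e0'.
- by move=> k kn; apply: al0; lia.
- by move=> k kn; apply: be0; lia.
split=> k; rewrite leq_eqVlt => /orP[/eqP|]; rewrite ?ltnS.
- by move=> ->.
- exact: ha.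
- by move=> [->].
- exact: hb.
Qed.

Lemma div_lt0 (x y : R) : x * y < 0 -> x / y < 0.
Proof.
move=> xy; have y0 : y != 0 by apply: contraTneq xy => ->; rewrite mulr0 ltxx.
have -> : x / y = x * y * y^-1 ^+ 2 by field.
by rewrite nmulr_rlt0 // exprn_even_gt0 // invr_eq0 y0 orbT.
Qed.

Lemma div_gt0 (x y : R) : 0 < x * y -> 0 < x / y.
Proof.
by move=> xy; rewrite -oppr_lt0 -mulNr div_lt0 // mulNr oppr_lt0.
Qed.

(* The sign condition says that Q / P has positive residues at the nodes l. *)
Definition admissible n (l : 'rV[R]_n.+1) P Q :=
  [/\ forall j, 0 < l 0 j, increasing l, P = root_poly l &
      forall j, 0 < Q.[l 0 j] * P^`().[l 0 j]].

(** If [m] lists the roots of the previous polynomial, the recurrence lets [roots_outside] place the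
    new roots around [m], and interlacing returns the sign condition. *)
Lemma admissible_tail_poly al be n :
  (forall k, (k <= n)%N -> 0 < al k) -> (forall k, (k < n)%N -> 0 < be k) ->
  exists l : 'rV_n.+1, admissible l (tail_poly al be n.+1) (tail_poly al be n).
Proof.
elim: n => [|n IH] al0 be0.
  exists (const_mx (al 0%N)); split=> [j|i j||j].
  - by rewrite mxE al0.
  - by rewrite !ord1.
  - by rewrite tail_poly1 /root_poly big_ord1 mxE.
  - by rewrite tail_poly1 !derivE !hornerE.
have [||m [m0 minc Qm Rsgn]] := IH.
- by move=> k kn; apply: al0; lia.
- by move=> k kn; apply: be0; lia.
have [||j||l [linc l0 lm Pl]] := @roots_outside R n m (tail_poly al be n.+2) minc m0.
- exact: tail_poly_monic.
- exact: size_tail_poly.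
(* At a root of Q only -be X S survives; its sign is opposite to that of S, which agrees with Q' by
   induction. *)
- rewrite -Qm tail_polySS [in X in X * _]Qm.
  rewrite !hornerE (root_root_poly m _).2; last by exists j.
  have := be0 n (ltnSn n); have := m0 j; have := Rsgn j.
  set x := _.[_]; set y := _.[_]; set z := m _ _ => xy z0 b0.
  rewrite mulr0 sub0r -!mulrA mulNr oppr_lt0 -!mulrA.
  by rewrite pmulr_rgt0 // pmulr_rgt0.
(* Here P(0) Q(0) = -al Q(0)^2. *)
- rewrite -Qm tail_poly_horner0 !mulNr -mulrA oppr_lt0.
  rewrite pmulr_rgt0 ?al0 // -expr2 exprn_even_gt0 // tail_poly_horner0_neq0 ?orbT //.
  by move=> k kn; apply: al0; lia.
exists l; split=> // j; rewrite Pl Qm; exact: interlacing_outer_sign.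
Qed.

Lemma tail_poly_surj n (l : 'rV[R]_n.+1) P Q : admissible l P Q -> Q \is monic ->
  size Q = n.+1 -> exists al be,
  [/\ forall k, (k <= n)%N -> 0 < al k, forall k, (k < n)%N -> 0 < be k,
      P = tail_poly al be n.+1 & Q = tail_poly al be n].
Proof.
elim: n l P Q => [|n IH] l P Q [l0 linc Pl sgn] Qm sQ.
  exists (fun=> l 0 0), (fun=> 1); split=> //.
    by rewrite tail_poly1 Pl /root_poly big_ord1.
  have /size_poly1P[c c0 E] : size Q == 1%N by rewrite sQ.
  by move: Qm; rewrite E monicE lead_coefC => /eqP ->.
(* At the nodes [Q] has the sign of P', which alternates. *)
have [|m lm Qr] := roots_between linc Qm sQ.
  move=> k; apply: (signs_transfer (u := - P^`().[l 0 (ord_cur k)])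
    (v := - P^`().[l 0 (ord_next k)])); rewrite ?mulrN ?oppr_lt0 //.
  by rewrite mulNr oppr_gt0 Pl; apply: deriv_root_poly_alternate.
have minc := interlacing_increasing linc lm.
have m0 := interlacing_pos l0 lm.
have PQ0 : P.[0] * Q.[0] < 0 by rewrite Pl Qr; apply: interlacing_horner0_sign.
have Q0 : Q.[0] != 0 by apply: contraTneq PQ0 => ->; rewrite mulr0 ltxx.
(* The value forced by [tail_poly_horner0]; it makes P - (X - a) Q divisible by X. *)
pose a := - P.[0] / Q.[0].
have a0 : 0 < a.
  by rewrite /a mulNr oppr_gt0 div_lt0.
have /factor_theorem[S] : root (P - ('X - a%:P) * Q) 0.
  by apply/rootP; rewrite !hornerE /a; field.
rewrite subr0 => DS.
have sS : (size S <= n.+1)%N.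
  (* Both terms are monic of degree n + 2, so the leading terms cancel. *)
  have /leq_sizeP sD : (size (P - ('X - a%:P) * Q)%R <= n.+2)%N.
    apply: size_monicB.
    - by rewrite Pl root_poly_monic.
    - by rewrite monicMl ?monicXsubC.
    - by rewrite Pl size_root_poly.
    - by rewrite size_monicM ?monicXsubC ?monic_neq0 // size_XsubC sQ.
  apply/leq_sizeP => k nk; have := coefMX S k.+1.
  by rewrite -DS /= => <-; apply: sD.
(* At a root of [Q], P = X S with X positive, so [S] has the sign of [P], opposite to that of Q'. *)
have Ssgn j : S.[m 0 j] * Q^`().[m 0 j] < 0.
  have Qj : Q.[m 0 j] = 0 by rewrite Qr (root_root_poly _ _).2 //; exists j.
  have := interlacing_inner_sign j linc lm; rewrite -Pl -Qr.
  have : (P - ('X - a%:P) * Q).[m 0 j] = (S * 'X).[m 0 j] by rewrite DS.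
  by rewrite !hornerE Qj mulr0 subr0 => ->; rewrite mulrAC pmulr_llt0.
(* [c] is the sum of the residues of S / Q, all negative. Hence [- c] is a valid new [be], and
   scaling by [c^-1] makes the residues positive. *)
pose c := S`_n.
have c0 : c < 0.
  rewrite /c (lead_coef_at_nodes minc sS) -oppr_gt0 -sumrN (bigD1 ord0) //=.
  have pos j : 0 < - (S.[m 0 j] / (root_poly m)^`().[m 0 j]).
    by rewrite oppr_gt0 div_lt0 // -Qr.
  by apply: ltr_wpDr; [apply: sumr_ge0 => j _; apply: ltW|].
have cN0 : c != 0 by rewrite lt_eqF.
have sS' : size S = n.+1.
  apply/eqP; rewrite eqn_leq sS ltnNge; apply: contra cN0 => /leq_sizeP h.
  by rewrite /c h.
have [|||al [be [al0 be0 Qa Sa]]] := IH m Q (c^-1 *: S).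
- split=> // j; rewrite hornerZ -mulrA.
  by rewrite nmulr_rgt0 // invr_lt0.
- by rewrite monicE lead_coefZ /lead_coef sS' mulVf.
- by rewrite size_scale ?invr_eq0.
(* Only the newest indices are overridden, and the polynomials of lower degree do not see them. *)
exists (fun k => if k == n.+1 then a else al k).
exists (fun k => if k == n then - c else be k).
have eQ : Q = tail_poly (fun k => if k == n.+1 then a else al k)
                        (fun k => if k == n then - c else be k) n.+1.
  rewrite Qa; apply: eq_tail_poly => k kn; rewrite ifN //; lia.
split=> // [k kn|k kn|].
- by case: eqP => // /eqP kn'; apply: al0; lia.
- by case: eqP => [_|/eqP kn']; [rewrite oppr_gt0|apply: be0; lia].
- rewrite tail_polySS -eQ !eqxx.
  have <- : c^-1 *: S = tail_poly (fun k => if k == n.+1 then a else al k)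
                        (fun k => if k == n then - c else be k) n.
    rewrite Sa; apply: eq_tail_poly => k kn; rewrite ifN //; lia.
  rewrite -[LHS](subrK (('X - a%:P) * Q)) DS addrC; congr (_ + _).
  by rewrite -!mul_polyC polyCN mulNr mulNr opprK mulrACA -polyCM mulfV // mul1r mulrC.
Qed.
End TailPoly.

(** * Eigenvectors of the pencil *)

Section Pencil.
Variable R : realType.

(** Kronecker deltas are boolean multiplicities, so the result vanishes by itself when [k] is out of
    range, as happens at the last row or column. *)
Lemma sum_delta_nat m (f : nat -> R) k :
  \sum_(j < m) f j *+ (j == k :> nat) = f k *+ (k < m)%N.
Proof.
case: ltnP => km.
  rewrite (bigD1 (Ordinal km)) //= eqxx big1 ?addr0 // => j jk.
  by rewrite -[_ == k]/(j == Ordinal km) (negbTE jk).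
by rewrite big1 // => j _; rewrite ltn_eqF // (leq_trans (ltn_ord j)).
Qed.

Lemma LmxE n (a : 'rV[R]_n.+1) i j :
  Lmx a i j = a 0 i *+ (i == j) + (j == i.+1 :> nat)%:R.
Proof.
rewrite !mxE summxE; congr (_ + _).
rewrite (eq_bigr (fun k : 'I_n => (j == i.+1 :> nat)%:R *+ (k == i :> nat))).
  rewrite (sum_delta_nat n (fun=> (j == i.+1 :> nat)%:R)).
  case: (eqVneq (j : nat) i.+1) => ji; last by rewrite mul0rn.
  by have := ltn_ord j; rewrite ji ltnS => ->.
move=> k _; rewrite mxE -mulrnA mulnb andbC; congr (_%:R).
rewrite -[i == _]/(i == k :> nat) -[j == ord_next k]/(j == k.+1 :> nat).
by rewrite [i == k :> nat]eq_sym; case: (eqVneq (k : nat) i) => [->|]; rewrite ?andbF.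
Qed.

Lemma MmxE n (b : 'rV[R]_n) i j :
  Mmx b i j = (i == j)%:R - extend 0 b j *+ (i == j.+1 :> nat).
Proof.
rewrite !mxE summxE; congr (_ - _).
rewrite (eq_bigr (fun k : 'I_n =>
   (extend 0 b k *+ (i == k.+1 :> nat)) *+ (k == j :> nat))).
  rewrite (sum_delta_nat n (fun k => extend 0 b k *+ (i == k.+1 :> nat))).
  case: (eqVneq (i : nat) j.+1) => ij; last by rewrite !mul0rn.
  by have := ltn_ord i; rewrite ij ltnS => ->.
move=> k _; rewrite !mxE extend_ord -mulrnA mulnb -[i == _]/(i == k.+1 :> nat).
by rewrite -[j == _]/(j == k :> nat) [j == k :> nat]eq_sym mulr_natr.
Qed.

Definition prev (f : nat -> R) (k : nat) : R := if k is k'.+1 then f k' else 0.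

Lemma sum_delta_natS m (f : nat -> R) k : (k <= m)%N ->
  \sum_(j < m) f j *+ (k == j.+1 :> nat) = prev f k.
Proof.
case: k => [|k] km /=; first by rewrite big1.
rewrite (eq_bigr (fun j : 'I_m => f j *+ (j == k :> nat))).
  by rewrite sum_delta_nat km.
by move=> j _; rewrite eqSS eq_sym.
Qed.

Variable n : nat.
Implicit Types (a : 'rV[R]_n.+1) (b : 'rV[R]_n) (f : nat -> R).

Lemma row_mul_Lmx a f j :
  ((\row_i f i) *m Lmx a) 0 j = extend 0 a j * f j + prev f j.
Proof.
rewrite mxE (eq_bigr (fun i : 'I_n.+1 => (extend 0 a i * f i) *+ (i == j :> nat)
  + f i *+ (j == i.+1 :> nat))).
  rewrite big_split /= (sum_delta_nat _ (fun i => extend 0 a i * f i)) ltn_ord.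
  by rewrite sum_delta_natS // ltnW.
move=> i _; rewrite [X in X * _]mxE LmxE mulrDr mulr_natr extend_ord mulrnAr mulrC.
by rewrite -[i == j]/(i == j :> nat).
Qed.

Lemma row_mul_Mmx b f j :
  ((\row_i f i) *m Mmx b) 0 j = f j - extend 0 b j * f j.+1.
Proof.
rewrite mxE (eq_bigr (fun i : 'I_n.+1 => f i *+ (i == j :> nat)
  - (extend 0 b j * f i) *+ (i == j.+1 :> nat))).
  rewrite sumrB sum_delta_nat (sum_delta_nat _ (fun i => extend 0 b j * f i)).
  rewrite ltn_ord; case: ltnP => // nj.
  by rewrite extend_ge // !mul0r mul0rn.
move=> i _; rewrite [X in X * _]mxE MmxE mulrBr mulr_natr mulrnAr mulrC.
by rewrite -[i == j]/(i == j :> nat).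
Qed.

(** The superdiagonal entries are 1, with no zero default to cut them off at the last row, so [f]
    itself must vanish there. *)
Lemma Lmx_mul_col a f i : f n.+1 = 0 ->
  (Lmx a *m (\col_i f i)) i 0 = extend 0 a i * f i + f i.+1.
Proof.
move=> fn; rewrite mxE (eq_bigr (fun j : 'I_n.+1 =>
  (extend 0 a i * f j) *+ (j == i :> nat) + f j *+ (j == i.+1 :> nat))).
  rewrite big_split /= (sum_delta_nat _ (fun j => extend 0 a i * f j)) ltn_ord.
  rewrite sum_delta_nat; case: ltnP => // ni.
  by rewrite (_ : i.+1 = n.+1) ?fn //; have := ltn_ord i; lia.
move=> j _; rewrite [X in _ * X]mxE LmxE mulrDl mulr_natl extend_ord mulrnAl.
by rewrite -[i == j]/(i == j :> nat) eq_sym.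
Qed.

Lemma Mmx_mul_col b f i :
  (Mmx b *m (\col_i f i)) i 0 = f i - prev (fun k => extend 0 b k * f k) i.
Proof.
rewrite mxE (eq_bigr (fun j : 'I_n.+1 =>
  f j *+ (j == i :> nat) - (extend 0 b j * f j) *+ (i == j.+1 :> nat))).
  rewrite sumrB sum_delta_nat ltn_ord.
  by rewrite (sum_delta_natS (fun j => extend 0 b j * f j)) // ltnW.
move=> j _; rewrite [X in _ * X]mxE MmxE mulrBl mulr_natl mulrnAl.
by rewrite -[i == j]/(i == j :> nat) eq_sym.
Qed.

(** Since the superdiagonal of L is 1, row k expresses y_{k+1} through y_k and y_{k-1}; the first
    entry determines all others. *)
Lemma right_kernel_eq0 a b z (y : 'cV[R]_n.+1) :
  Lmx a *m y = z *: (Mmx b *m y) -> y ord0 0 = 0 -> y = 0.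
Proof.
pose f := extend 0 y^T; have fy (i : 'I_n.+1) : f i = y i 0.
  by rewrite /f extend_ord mxE.
have -> : y = \col_i f i by apply/colP => i; rewrite mxE fy.
move=> eig; rewrite mxE => f0.
have fge k : (n < k)%N -> f k = 0 by apply: extend_ge.
clearbody f; have h k : forall i, (i <= k)%N -> f i = 0.
  elim: k => [|k IH] i; first by rewrite leqn0 => /eqP ->.
  rewrite leq_eqVlt => /orP[/eqP ->|]; last by rewrite ltnS; apply: IH.
  have [nk|kn] := leqP n k; first by rewrite fge.
  move/colP/(_ (Ordinal (ltnW kn : k < n.+1)%N)): eig.
  rewrite [RHS]mxE Mmx_mul_col Lmx_mul_col ?(fge n.+1) //= IH //.
  rewrite mulr0 add0r sub0r => ->.
  case: k IH {kn} => [|k] IH /=; first by rewrite oppr0 mulr0.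
  by rewrite IH // mulr0 oppr0 mulr0.
by apply/colP => i; rewrite !mxE; apply: h (leqnn _).
Qed.

(** The same propagation along columns, where u_{k+1} comes with the factor z b_k; hence the two
    nonvanishing hypotheses. *)
Lemma left_kernel_eq0 a b z (u : 'cV[R]_n.+1) :
  z != 0 -> (forall k, b 0 k != 0) ->
  u^T *m Lmx a = z *: (u^T *m Mmx b) -> u ord0 0 = 0 -> u = 0.
Proof.
move=> z0 b0.
pose f := extend 0 u^T; have fy (i : 'I_n.+1) : f i = u i 0.
  by rewrite /f extend_ord mxE.
have -> : u^T = \row_i f i by apply/rowP => i; rewrite !mxE fy.
move=> eig; rewrite -fy => f0.
have fge k : (n < k)%N -> f k = 0 by apply: extend_ge.
clearbody f; have h k : forall i, (i <= k)%N -> f i = 0.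
  elim: k => [|k IH] i; first by rewrite leqn0 => /eqP ->.
  rewrite leq_eqVlt => /orP[/eqP ->|]; last by rewrite ltnS; apply: IH.
  have [nk|kn] := leqP n k; first by rewrite fge.
  move/rowP/(_ (Ordinal (ltnW kn : k < n.+1)%N)): eig.
  rewrite row_mul_Lmx mxE row_mul_Mmx /= IH // mulr0 add0r sub0r.
  have -> : prev f k = 0 by case: k IH {kn} => [|k] IH //=; rewrite IH.
  move/esym/eqP; rewrite mulf_eq0 (negbTE z0) oppr_eq0 mulf_eq0 /=.
  by rewrite (extend_ord 0 b (Ordinal kn)) (negbTE (b0 _)) => /eqP.
by apply/colP => i; rewrite !mxE -fy; apply: h (leqnn _).
Qed.

(* trailing_det a b k is the determinant of the trailing k x k block of
   'X M - L; the parameters are read backwards so that the recursion on k adds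
   the rows from the bottom. *)
Definition trailing_det a b : nat -> {poly R} :=
  tail_poly (fun k => extend 0 a (n - k)) (fun k => extend 0 b (n.-1 - k)).

Lemma trailing_detE a b k : (k <= n)%N ->
  trailing_det a b (n - k).+1 = ('X - (extend 0 a k)%:P) * trailing_det a b (n - k)
    - (extend 0 b k)%:P * 'X * trailing_det a b (n - k.+1).
Proof.
move=> kn; rewrite /trailing_det; case E: (n - k)%N => [|m].
  (* Here [n - k.+1] is truncated to 0, and the default [extend 0 b n = 0] removes the spurious
     term. *)
  have -> : k = n by lia.
  by rewrite tail_poly1 subn0 [extend 0 b n]extend_ge //= mulr1 !mul0r subr0.
rewrite tail_polySS; have -> : (n - k.+1)%N = m by lia.
have -> : (n - m.+1)%N = k by lia.
by have -> : (n.-1 - m)%N = k by lia.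
Qed.

(** [left_vec] is the first row, and [right_vec] the first column, of the adjugate of zM - L: each
    minor splits into a triangular block and a trailing determinant. *)
Definition left_vec a b z : 'rV[R]_n.+1 :=
  \row_j (trailing_det a b (n - j)).[z].
Definition right_seq a b z (i : nat) : R :=
  (\prod_(k < i) (z * extend 0 b k)) * (trailing_det a b (n - i)).[z].
Definition right_vec a b z : 'cV[R]_n.+1 := \col_i right_seq a b z i.

(** Holds for every [z], not only at eigenvalues, so it may be differentiated in [z]. *)
Lemma left_vec_pencil a b z :
  z *: (left_vec a b z *m Mmx b) - left_vec a b z *m Lmx a =
  (trailing_det a b n.+1).[z] *: delta_mx 0 0.
Proof.
apply/rowP => j; rewrite [LHS]mxE [X in X + _]mxE [X in _ + X]mxE.
rewrite (row_mul_Lmx a (fun j => (trailing_det a b (n - j)).[z])).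
rewrite (row_mul_Mmx b (fun j => (trailing_det a b (n - j)).[z])).
rewrite !mxE /=; move: (trailing_det a b) (trailing_detE a b (leq_ord j)) => T.
move/(congr1 (fun p => p.[z])); rewrite !hornerE.
case: j => [[|j] jn] /=.
  by rewrite !subn0 => ->; ring.
have -> : (n - j.+1).+1 = (n - j)%N by lia.
by rewrite mulr0 => ->; ring.
Qed.

(** The z-derivative of [left_vec_pencil], obtained from the differentiated recurrence. *)
Lemma deriv_left_vec_pencil a b z :
  let u' : 'rV[R]_n.+1 := \row_j ((trailing_det a b (n - j))^`()).[z] in
  z *: (u' *m Mmx b) - u' *m Lmx a + left_vec a b z *m Mmx b =
  (trailing_det a b n.+1)^`().[z] *: delta_mx 0 0.
Proof.
move=> u'; apply/rowP => j.
rewrite [LHS]mxE [X in X + _]mxE [X in X + _ + _]mxE [X in _ + X + _]mxE.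
rewrite (row_mul_Lmx a (fun j => (trailing_det a b (n - j))^`().[z])).
rewrite (row_mul_Mmx b (fun j => (trailing_det a b (n - j))^`().[z])).
rewrite (row_mul_Mmx b (fun j => (trailing_det a b (n - j)).[z])).
rewrite !mxE /=; move: (trailing_det a b) (trailing_detE a b (leq_ord j)) => T.
move/(congr1 (fun p => p^`().[z])); rewrite !derivE !hornerE.
case: j => [[|j] jn] /=.
  by rewrite !subn0 => ->; rewrite ?mulr1; ring.
have -> : (n - j.+1).+1 = (n - j)%N by lia.
by rewrite mulr0 => ->; ring.
Qed.

Lemma right_vec_pencil a b z : (trailing_det a b n.+1).[z] = 0 ->
  Lmx a *m right_vec a b z = z *: (Mmx b *m right_vec a b z).
Proof.
move=> root; apply/colP => i.
(* [right_seq] vanishes at [n.+1] because its product contains [extend 0 b n = 0]. *)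
rewrite [RHS]mxE Mmx_mul_col Lmx_mul_col; last first.
  by rewrite /right_seq big_ord_recr /= extend_ge // mulr0 mulr0 mul0r.
rewrite /right_seq.
move: (trailing_det a b) (trailing_detE a b (leq_ord i)) root => T + root.
move/(congr1 (fun p => p.[z])); rewrite !hornerE.
case: i => [[|i] j_n] /=.
  rewrite !subn0 root big_ord0 big_ord1 => h; apply/eqP.
  by rewrite -subr_eq0; apply/eqP; rewrite -[RHS]oppr0 [in RHS]h; ring.
have -> : (n - i.+1).+1 = (n - i)%N by lia.
by rewrite !big_ord_recr /= => ->; ring.
Qed.

Definition spectral_data a b (l : 'rV[R]_n.+1) :=
  admissible l (trailing_det a b n.+1) (trailing_det a b n).

Lemma gen_eigenvalueP a b l z : spectral_data a b l ->
  gen_eigenvalue (Lmx a) (Mmx b) z <-> exists j, z = l 0 j.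
Proof.
move=> [l0 linc Pl sgn]; rewrite -root_root_poly -Pl; split=> [[x x0 eig]|Pz].
  (* Applying [left_vec_pencil] to the eigenvector gives P(z) x_0 = 0, and x_0 = 0 would force x =
     0. *)
  have : (z *: (left_vec a b z *m Mmx b) - left_vec a b z *m Lmx a) *m x = 0.
    by rewrite mulmxBl -scalemxAl -!mulmxA eig -scalemxAr subrr.
  rewrite left_vec_pencil -scalemxAl => /matrixP/(_ 0 0).
  rewrite mxE [in X in _ * X]mxE (bigD1 0) //= big1 ?addr0 => [|j j0].
    rewrite !mxE eqxx mul1r => /eqP; rewrite mulf_eq0 => /orP[/eqP //|/eqP x00].
    by rewrite (right_kernel_eq0 eig x00) eqxx in x0.
  by rewrite mxE (negbTE j0) andbF mul0r.
exists (right_vec a b z); last exact: right_vec_pencil.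
(* The first entry of [right_vec] is Q(l_j), nonzero by the sign condition. *)
have [j zj] : exists j, z = l 0 j by rewrite -root_root_poly -Pl.
apply: contraTneq (sgn j) => /matrixP/(_ 0 0).
by rewrite !mxE /right_seq big_ord0 mul1r subn0 zj => ->; rewrite mul0r ltxx.
Qed.

Lemma eigenvaluesE a b l : spectral_data a b l ->
  eigenvalues (Lmx a) (Mmx b) = l.
Proof.
move=> sd; have [l0 linc Pl sgn] := sd.
apply: xget_unique => [|m [minc meig]].
  by split=> // z; apply: gen_eigenvalueP.
by apply: increasing_eq => // z; rewrite -meig; apply: gen_eigenvalueP.
Qed.

(** Two normalized solutions differ by a solution with first entry 0, so [right_kernel_eq0] makes
    the rescaled [right_vec] the only one. *)
Lemma right_eigenvectorE a b z : (trailing_det a b n.+1).[z] = 0 ->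
  (trailing_det a b n).[z] != 0 -> right_eigenvector (Lmx a) (Mmx b) z =
  (trailing_det a b n).[z]^-1 *: right_vec a b z.
Proof.
move=> Pz Qz; set v := _ *: _.
have veig : Lmx a *m v = z *: (Mmx b *m v).
  by rewrite -!scalemxAr right_vec_pencil // !scalerA mulrC.
have v0 : v ord0 0 = 1.
  by rewrite !mxE /right_seq big_ord0 mul1r subn0 mulVf.
apply: xget_unique => // y [yeig y0]; apply/eqP; rewrite -subr_eq0; apply/eqP.
apply: (@right_kernel_eq0 a b z); last by rewrite !mxE y0 -v0 !mxE subrr.
by rewrite !mulmxBr yeig veig scalerBr.
Qed.

Lemma left_eigenvectorE a b z : z != 0 -> (forall k, b 0 k != 0) ->
  (trailing_det a b n.+1).[z] = 0 -> (trailing_det a b n).[z] != 0 ->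
  left_eigenvector (Lmx a) (Mmx b) z =
  (trailing_det a b n).[z]^-1 *: (left_vec a b z)^T.
Proof.
move=> z0 b0 Pz Qz; set u := _ *: _.
have ueig : u^T *m Lmx a = z *: (u^T *m Mmx b).
  rewrite linearZ /= trmxK -!scalemxAl scalerA mulrC -scalerA; congr (_ *: _).
  apply/eqP; rewrite eq_sym -subr_eq0; apply/eqP.
  by rewrite left_vec_pencil Pz scale0r.
have u0 : u ord0 0 = 1 by rewrite !mxE subn0 mulVf.
apply: xget_unique => // y [yeig y0]; apply/eqP; rewrite -subr_eq0; apply/eqP.
apply: (@left_kernel_eq0 a b z) => //; last by rewrite !mxE y0 -u0 !mxE subrr.
by rewrite linearB /= !mulmxBl yeig ueig scalerBr.
Qed.

(** Multiply [deriv_left_vec_pencil] on the right by [right_vec]: the terms in u' cancel by the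
    eigenvector equation, leaving P'(z) times the first entry Q(z). *)
Lemma left_right_pairing a b z : (trailing_det a b n.+1).[z] = 0 ->
  (left_vec a b z *m Mmx b *m right_vec a b z) 0 0 =
  (trailing_det a b n.+1)^`().[z] * (trailing_det a b n).[z].
Proof.
move=> Pz; have /= := deriv_left_vec_pencil a b z.
set u' := \row_j _ => /(congr1 (mulmx^~ (right_vec a b z))) /=.
rewrite mulmxDl mulmxBl -scalemxAl -!mulmxA right_vec_pencil // -scalemxAr.
rewrite subrr add0r -scalemxAl mulmxA => /matrixP/(_ 0 0) ->.
rewrite mxE [in X in _ * X]mxE (bigD1 0) //= big1 ?addr0 => [|j j0].
  by rewrite !mxE eqxx mul1r /right_seq big_ord0 mul1r subn0.
by rewrite mxE (negbTE j0) andbF mul0r.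
Qed.

(** Each normalization divides by Q, so the pairing becomes P' Q / Q^2 = P' / Q. *)
Lemma weightE a b l j : (forall k, b 0 k != 0) -> spectral_data a b l ->
  weight (Lmx a) (Mmx b) (l 0 j) =
  (trailing_det a b n).[l 0 j] / (trailing_det a b n.+1)^`().[l 0 j].
Proof.
move=> b0 [l0 linc Pl sgn].
have Pz : (trailing_det a b n.+1).[l 0 j] = 0.
  by rewrite Pl root_root_poly; exists j.
have Qz : (trailing_det a b n).[l 0 j] != 0.
  by apply: contraTneq (sgn j) => ->; rewrite mul0r ltxx.
have P'z : (trailing_det a b n.+1)^`().[l 0 j] != 0.
  by apply: contraTneq (sgn j) => ->; rewrite mulr0 ltxx.
have lj : l 0 j != 0 by rewrite gt_eqF.
rewrite /weight (left_eigenvectorE lj b0 Pz Qz) (right_eigenvectorE Pz Qz).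
rewrite [(_ *: _)^T]linearZ /= trmxK -!scalemxAl -scalemxAr [X in X^-1]mxE [X in (_ * X)^-1]mxE left_right_pairing //.
by field; rewrite Qz P'z.
Qed.

(** * Bijectivity of the spectral transform *)

Lemma spectral_transformE ab : pos_params R n ab ->
  exists2 l, spectral_data ab.1 ab.2 l & spectral_transform ab =
    (l, \row_j ((trailing_det ab.1 ab.2 n).[l 0 j] /
                (trailing_det ab.1 ab.2 n.+1)^`().[l 0 j])).
Proof.
case: ab => a b [/= a0 b0].
have [||l sd] := @admissible_tail_poly R (fun k => extend 0 a (n - k))
    (fun k => extend 0 b (n.-1 - k)) n.
- move=> k kn; have kn' : (n - k < n.+1)%N by lia.
  by rewrite (extend_ord 0 a (Ordinal kn')).
- move=> k kn; have kn' : (n.-1 - k < n)%N by lia.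
  by rewrite (extend_ord 0 b (Ordinal kn')).
exists l => //; rewrite /spectral_transform /= (@eigenvaluesE a b l sd).
congr pair; apply/rowP => j; rewrite !mxE (@weightE a b l j _ sd) // => k.
by rewrite gt_eqF.
Qed.

Lemma trailing_det_monic a b k : trailing_det a b k \is monic.
Proof. exact: tail_poly_monic. Qed.

Lemma size_trailing_det a b k : size (trailing_det a b k) = k.+1.
Proof. exact: size_tail_poly. Qed.

(** The weights are the residues of Q / P, so their sum is the leading coefficient of the monic
    Q. *)
Lemma spectral_transform_Lambda ab : pos_params R n ab ->
  Lambda R n (spectral_transform ab).
Proof.
move=> /spectral_transformE[l [l0 linc Pl sgn] ->]; split=> //= [j|].
  by rewrite mxE div_gt0.
under eq_bigr do rewrite mxE.
have /monicP := trailing_det_monic ab.1 ab.2 n.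
by rewrite Pl -lead_coef_at_nodes // ?/lead_coef size_trailing_det.
Qed.

Lemma spectral_transform_inj ab ab' :
  pos_params R n ab -> pos_params R n ab' ->
  spectral_transform ab = spectral_transform ab' -> ab = ab'.
Proof.
move=> pab pab'; have [l [_ linc Pl _] ->] := spectral_transformE pab.
have [l' [_ _ Pl' _] ->] := spectral_transformE pab'.
move=> [ll' /rowP ww']; rewrite -{l'}ll' in Pl' ww' *.
have PP : trailing_det ab.1 ab.2 n.+1 = trailing_det ab'.1 ab'.2 n.+1.
  by rewrite Pl Pl'.
(* Q has degree n, and the weights prescribe its values at n + 1 nodes. *)
have QQ : trailing_det ab.1 ab.2 n = trailing_det ab'.1 ab'.2 n.
  apply: (poly_eq_at_nodes linc) => [||j]; rewrite ?size_trailing_det //.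
  move: (ww' j); rewrite !mxE Pl Pl'; apply: mulIf.
  by rewrite invr_eq0 deriv_root_poly_neq0.
case: ab ab' pab pab' PP QQ {Pl Pl' ww'} => [a b] [a' b'] [a0 b0] _ PP QQ.
have [||ha hb] := tail_poly_inj _ _ PP QQ => /=.
- move=> k kn; have kn' : (n - k < n.+1)%N by lia.
  by rewrite (extend_ord 0 a (Ordinal kn')).
- move=> k kn; have kn' : (n.-1 - k < n)%N by lia.
  by rewrite (extend_ord 0 b (Ordinal kn')).
congr pair; apply/rowP => i.
  have := ha (n - i)%N (leq_subr _ _); rewrite subKn ?leq_ord //.
  by rewrite !extend_ord.
have i_n := ltn_ord i; have := hb (n.-1 - i)%N.
have -> : (n.-1 - (n.-1 - i))%N = i by lia.
by rewrite !extend_ord; apply; lia.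
Qed.

Lemma spectral_transform_surj lw : Lambda R n lw ->
  exists2 ab, pos_params R n ab & spectral_transform ab = lw.
Proof.
case: lw => l w [/= l0 linc w0 w1].
(* The candidate for Q is the numerator with residues [w]; total mass 1 makes it monic of degree
   n. *)
have cQ : (interpolant l w)`_n = 1 by rewrite coef_interpolant.
have sQ : size (interpolant l w) = n.+1.
  apply/eqP; rewrite eqn_leq size_interpolant ltnNge; apply/negP => /leq_sizeP h.
  by move: cQ; rewrite h // => /esym/eqP; rewrite oner_eq0.
have Qm : interpolant l w \is monic by rewrite monicE /lead_coef sQ /= cQ.
have [|al [be [al0 be0 Pt Qt]]] := @tail_poly_surj R n l (root_poly l) _ _ Qm sQ.
  (* Q(l_j) P'(l_j) = w_j P'(l_j)^2. *)
  split=> // j; rewrite horner_interpolant -mulrA -expr2 mulr_gt0 //.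
  by rewrite exprn_even_gt0 //= deriv_root_poly_neq0.
(* Undoes the backward reading of the parameters in [trailing_det]. *)
pose a : 'rV_n.+1 := \row_i al (n - i)%N.
pose b : 'rV_n := \row_i be (n.-1 - i)%N.
have aE k : (k <= n)%N -> extend 0 a (n - k) = al k.
  move=> kn; have kn' : (n - k < n.+1)%N by lia.
  by rewrite (extend_ord 0 a (Ordinal kn')) mxE /= subKn.
have bE k : (k < n)%N -> extend 0 b (n.-1 - k) = be k.
  move=> kn; have kn' : (n.-1 - k < n)%N by lia.
  by rewrite (extend_ord 0 b (Ordinal kn')) mxE /=; congr be; lia.
have pab : pos_params R n (a, b).
  by split=> i /=; rewrite mxE; [apply: al0|apply: be0]; have := ltn_ord i; lia.
have PE : trailing_det a b n.+1 = root_poly l.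
  by rewrite Pt; apply: eq_tail_poly => k kn; [apply: aE|apply: bE].
have QE : trailing_det a b n = interpolant l w.
  by rewrite Qt; apply: eq_tail_poly => k kn; [apply: aE|apply: bE]; lia.
exists (a, b) => //; have [m [_ minc Pm _] ->] := spectral_transformE pab.
have -> : m = l.
  apply: increasing_eq => // z.
  by rewrite -!root_root_poly -PE -Pm.
congr pair; apply/rowP => j; rewrite mxE /= PE QE horner_interpolant mulfK //.
exact: deriv_root_poly_neq0.
Qed.

End Pencil.

Theorem mainTheorem1 (R : realType) (n : nat) :
  set_bij (pos_params R n) (Lambda R n) spectral_transform.
Proof.
split=> [ab|ab ab'|lw].
- exact: spectral_transform_Lambda.
- by rewrite !inE => *; apply: spectral_transform_inj.
- by move=> /spectral_transform_surj[ab pab <-]; exists ab.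
Qed.
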